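(* Let $q$ be an odd prime power, $n\geq1$, $A=\mathbb{F}_q^n$ (as an additive group) and $H\subseteq\operatorname{GL}_n(q)$ a subgroup acting transitively on the nonzero elements of $A$; let $AH=A\rtimes H$ be the corresponding affine group, and let $m=(|A|-1)/2$. Suppose that $n>1$, or $n=1$ and $q$ is not a prime. Then there exists an absolutely irreducible fixed-point subgroup of $\operatorname{Sp}_{2m}(2)$ isomorphic to $AH$.
   Context: A subgroup $X\subseteq\operatorname{GL}(V)$ is a fixed-point subgroup if $\det(x-1)=0$ for every $x\in X$. $\operatorname{Sp}_{2m}(2)$ is the symplectic group of a non-degenerate alternating form on $\mathbb{F}_2^{2m}$. *)

(* Defs.v *)
From HB Require Import structures.
From mathcomp Require Import all_boot all_order all_algebra.
From mathcomp Require Import all_fingroup all_solvable all_field all_character.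
From mathcomp Require Export sesquilinear.

Set Implicit Arguments.
Unset Strict Implicit.
Unset Printing Implicit Defensive.

Import GroupScope GRing.Theory.
Local Open Scope ring_scope.

Section LinearGroups.

(* {'GL_n[F]} consists of invertible matrices of size n.-1.+1, which is n as   *)
(* soon as n > 0; they act on row vectors by right multiplication.            *)

Variables (F : finFieldType) (n : nat).

Definition natural_repr (X : {group {'GL_n[F]}}) :
    mx_representation F X n.-1.+1 :=
  subg_repr (GLrepr F n.-1) (subsetT X).

(* The pairs (h, a) with h \in H and a : 'rV_n.-1.+1, with product            *)
(* (h, a) (k, b) = (h k, a k + b): the map x |-> x h + a followed by          *)
(* x |-> x k + b.                                                             *)
Definition affine_group (H : {group {'GL_n[F]}}) : finGroupType :=
  sdprod_by ('MR (natural_repr H))%gact.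

Definition fixed_point_subgroup (X : {group {'GL_n[F]}}) : Prop :=
  forall x, x \in X -> \det (GLval x - 1) = 0.

(* In characteristic 2, is_psymplectic f says exactly that f is alternating   *)
(* and non-degenerate; skew-symmetry alone would not give f u u = 0.          *)
Definition Sp (f : {skew_symmetric 'rV[F]_n.-1.+1}) : {set {'GL_n[F]}} :=
  [set g | [forall u, forall v, f (u *m GLval g) (v *m GLval g) == f u v]].

Lemma SpP (f : {skew_symmetric 'rV[F]_n.-1.+1}) (g : {'GL_n[F]}) :
  reflect (forall u v, f (u *m GLval g) (v *m GLval g) = f u v) (g \in Sp f).
Proof.
rewrite inE; apply: (iffP forallP) => [fg u v | fg u].
  by have /forallP/(_ v)/eqP := fg u.
by apply/forallP=> v; apply/eqP.
Qed.

Fact Sp_group_set f : group_set (Sp f).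
Proof.
apply/group_setP; split=> [|g h /SpP fg /SpP fh]; apply/SpP=> u v.
  by rewrite GL_1E !mulmx1.
by rewrite GL_ME !mulmxA fh fg.
Qed.
Canonical Sp_group f := Group (Sp_group_set f).

End LinearGroups.

(* Main.v *)
Require Import Defs.
From mathcomp Require Import all_boot all_order all_algebra.
From mathcomp Require Import all_fingroup all_solvable all_field all_character.

Set Implicit Arguments.
Unset Strict Implicit.
Unset Printing Implicit Defensive.

Import GroupScope GRing.Theory.
Local Open Scope ring_scope.

(* AH permutes A, hence acts on the space V of vectors of F_2^A with          *)
(* coordinate sum 0. As |A| is odd, F_2^A is the direct sum of V and the      *)
(* all-ones line, and the dot product is alternating and non-degenerate on V; *)
(* any two such forms of the same dimension are equivalent.                   *)
(*   Irreducibility: averaging a projection onto a submodule W of V over the  *)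
(* translations gives a projection that commutes with A. Such matrices        *)
(* commute with one another, so it coincides with its conjugates under H and  *)
(* commutes with AH; by 2-transitivity it is a combination of the identity    *)
(* and the all-ones matrix, which forces W = V. The same description of the   *)
(* commutant of AH shows that endomorphisms of V are scalar.                  *)
(*   Fixed points: if the orbit O of 0 under g is not all of A, then one of O *)
(* and its complement is non-empty of even size, and its indicator vector is  *)
(* a fixed vector of g in V. If O = A, then the linear part h of g has        *)
(* p-power order, so it is unipotent, and g^k maps 0 to 0 for k = |A| / p,    *)
(* because 1 + h + ... + h^(k-1) = (h - 1)^(k-1) = 0 unless |A| is prime.     *)

(** Here |A| = d + 1 with d = 2m even, and V is handled through a basis matrix [B] and a coordinate
    matrix [C]. Uniqueness of the symplectic form ([alternating_unit_congr]) lets [sum_zero_gram]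
    choose the basis so that the dot product on V has exactly the matrix of the given form [f]. The
    permutation action then lands in [Sp f] itself, and it is faithful by [sum_zero_mx_eq1].
    Absolute irreducibility combines [affine_submodule_full] (averaging over A, a normal abelian
    subgroup of odd order) with [affine_centralizer_scalar]. The fixed vectors come from
    [affine_orbit_proper]: no affine bijection permutes A in a single cycle when |A| is odd and not
    prime; [det_affine_sub1] turns this into the determinant condition. *)

Lemma perm_mx_conjE (R : nzRingType) n (s : 'S_n) (M : 'M[R]_n) i j :
  (perm_mx s *m M *m perm_mx s^-1) i j = M (s i) (s j).
Proof. by rewrite -row_permE -col_permE !mxE. Qed.

(** * Alternating matrices up to congruence *)

(** Stated through the quadratic values because in characteristic 2 skew-symmetry does not force a
    zero diagonal. *)
Definition alternating_mx (K : fieldType) n (M : 'M[K]_n) :=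
  forall x : 'rV_n, x *m M *m x^T = 0.

Lemma alternating_congr (K : fieldType) m n (P : 'M[K]_(m, n)) M :
  alternating_mx M -> alternating_mx (P *m M *m P^T).
Proof. by move=> altM x; have := altM (x *m P); rewrite trmx_mul !mulmxA. Qed.

Lemma alternating_skew (K : fieldType) n (M : 'M[K]_n) :
  alternating_mx M -> M^T = - M.
Proof.
move=> altM; apply/matrixP=> i j; apply/eqP; rewrite !mxE -addr_eq0; apply/eqP.
have e k l : (delta_mx 0 k *m M *m (delta_mx 0 l)^T : 'M_1) 0 0 = M k l.
  by rewrite -rowE trmx_delta -colE !mxE.
have := altM (delta_mx 0 i + delta_mx 0 j).
rewrite linearD /= !(mulmxDl, mulmxDr) !altM add0r addr0.
by move/matrixP/(_ 0 0); rewrite mxE !e mxE addrC.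
Qed.

Lemma alternating_diag (K : fieldType) n (M : 'M[K]_n) i :
  alternating_mx M -> M i i = 0.
Proof.
move/(_ (delta_mx 0 i))/matrixP/(_ 0 0).
by rewrite -rowE trmx_delta -colE !mxE.
Qed.

(** One step of the symplectic basis algorithm: split off a hyperbolic plane, whose matrix with
    entries j - i for i, j in {0, 1} has rows (0, 1) and (-1, 0), and keep its orthogonal
    complement. *)
Lemma alternating_mx_split (K : fieldType) n (M : 'M[K]_(2 + n)) :
    alternating_mx M -> M \in unitmx ->
  exists P : 'M[K]_(2 + n), exists M' : 'M[K]_n,
    [/\ P \in unitmx, alternating_mx M', M' \in unitmx &
        P *m M *m P^T =
        block_mx (\matrix_(i, j) (j%:R - i%:R)) 0 0 M'].
Proof.
move=> altM uM.
pose i0 : 'I_(2 + n) := lshift n 0; pose i1 : 'I_(2 + n) := lshift n 1.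
have [j Mj]: exists j, M i0 j != 0.
  apply/existsP; apply: contraLR uM; rewrite negb_exists => /forallP-M0.
  have /eqP: row i0 M = 0 by apply/rowP=> j; rewrite !mxE; apply/eqP/negPn/M0.
  rewrite rowE; apply: contraL => uM;
    apply/negP => /eqP/(congr1 (mulmxr (invmx M))).
  rewrite /= mulmxK // mul0mx => /matrixP/(_ 0 i0)/eqP.
  by rewrite !mxE !eqxx oner_eq0.
have nj0 : j != i0 by apply: contraNneq Mj => ->; rewrite alternating_diag.
(* [P0] moves the basis vector [j] to position 1 and rescales it so that it pairs to 1 with the
   vector at position 0. *)
pose d : 'rV[K]_(2 + n) := \row_k (if k == i1 then (M i0 j)^-1 else 1).
pose P0 := diag_mx d *m perm_mx (tperm i1 j).
have uP0: P0 \in unitmx.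
  rewrite unitmx_mul unitmx_perm andbT unitmxE det_diag unitfE.
  by apply/prodf_neq0 => k _; rewrite mxE; case: ifP;
    rewrite ?invr_eq0 ?oner_eq0.
pose M0 := P0 *m M *m P0^T.
have altM0: alternating_mx M0 by exact: alternating_congr.
have M0E k l : M0 k l = d 0 k * M (tperm i1 j k) (tperm i1 j l) * d 0 l.
  have -> : M0 = diag_mx d *m (perm_mx (tperm i1 j) *m M
                 *m perm_mx (tperm i1 j)^-1) *m diag_mx d.
    by rewrite /M0 /P0 trmx_mul tr_diag_mx tr_perm_mx !mulmxA.
  by rewrite mul_mx_diag mxE mul_diag_mx [X in X * _]mxE perm_mx_conjE.
pose S : 'M[K]_2 := \matrix_(i, k) (k%:R - i%:R).
have M01: M0 i0 i1 = 1.
  rewrite M0E tpermL tpermD // 1?eq_sym // !mxE eqxx /=.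
  by rewrite mul1r divff.
have M10 : M0 i1 i0 = -1.
  by rewrite -M01 -[LHS](mxE trmx_key (fun i j => M0 j i)) -/(trmx M0)
    (alternating_skew altM0) mxE.
have ord2P (k : 'I_2) : k = 0 \/ k = 1.
  by case: k => [[|[|k]] //= ?]; [left | right]; apply: val_inj.
have M0diag k : M0 k k = 0 by exact: alternating_diag.
have ulE : ulsubmx M0 = S.
  move: M0 M01 M10 M0diag {altM0 M0E} => M0 M01 M10 M0diag.
  apply/matrixP=> k l; rewrite !mxE.
  have [-> | ->] := ord2P k; have [-> | ->] := ord2P l.
  - by rewrite M0diag subrr.
  - by rewrite M01 subr0.
  - by rewrite M10 sub0r.
  by rewrite M0diag subrr.
have uS : S \in unitmx.
  rewrite unitmxE (expand_det_row _ 0) !big_ord_recl big_ord0 /cofactor !mxE /=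
    subrr.
  rewrite mul0r add0r addr0 subr0 mul1r det_mx11 !mxE /=.
  by rewrite sub0r mulN1r opprK unitr1.
(* Schur complement: [L] clears the block below the plane, and skew-symmetry then kills the block to
   its right. *)
pose L := block_mx 1%:M 0 (- (dlsubmx M0 *m invmx S)) 1%:M.
have uL : L \in unitmx by rewrite unitmxE det_lblock !det1 mulr1 unitr1.
pose R := L *m M0 *m L^T.
have altR : alternating_mx R by exact: alternating_congr.
have RE : exists X, exists M', R = block_mx S X 0 M'.
  rewrite /R -(submxK M0) /L tr_block_mx !mulmx_block ulE.
  rewrite !(mul1mx, mul0mx, addr0, add0r, trmx1, trmx0, mulmx1, mulmx0).
  by rewrite mulNmx mulmxKV // addNr mul0mx add0r; do 2!eexists.
have [X [M' RE']] := RE.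
have X0 : X = 0.
  have := alternating_skew altR; rewrite RE' tr_block_mx opp_block_mx trmx0.
  by case/eq_block_mx=> _ /esym/eqP; rewrite oppr_eq0 => /eqP.
exists (L *m P0); exists M'.
have RE2 : L *m P0 *m M *m (L *m P0)^T = R
  by rewrite /R /M0 trmx_mul !mulmxA.
split.
- by rewrite unitmx_mul uL.
- move=> x; have := altR (row_mx 0 x); rewrite RE' X0 tr_row_mx trmx0.
  by rewrite mul_row_block mul_row_col !(mul0mx, mulmx0, add0r).
- have : R \in unitmx.
    have uLP : L *m P0 \in unitmx by rewrite unitmx_mul uL uP0.
    by rewrite -RE2 !(unitmx_mul (_ *m M)) unitmx_mul unitmx_tr uLP uM.
  by rewrite RE' !unitmxE det_ublock unitrM => /andP[].
by rewrite RE2 RE' X0.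
Qed.

(** Induction in steps of 2, reducing both matrices to the same normal form. Size 1 is vacuous,
    since a 1 x 1 alternating matrix is zero. *)
Lemma alternating_unit_congr (K : fieldType) n (M N : 'M[K]_n) :
    alternating_mx M -> M \in unitmx -> alternating_mx N -> N \in unitmx ->
  exists2 P, P \in unitmx & P *m M *m P^T = N.
Proof.
elim/ltn_ind: n => -[|[|n]] IHn in M N *.
- by move=> _ _ _ _; exists 1%:M; rewrite ?unitmx1 // !flatmx0.
- move=> altM; rewrite unitmxE det_mx11 alternating_diag //.
  by rewrite unitr0.
move=> altM uM altN uN.
have [P [M' [uP altM' uM' PE]]] := @alternating_mx_split K n M altM uM.
have [Q [N' [uQ altN' uN' QE]]] := @alternating_mx_split K n N altN uN.
have [T uT TE] := IHn n (ltnW (ltnSn _)) M' N' altM' uM' altN' uN'.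
pose B : 'M[K]_(2 + n) := block_mx 1%:M 0 0 T.
have uB : B \in unitmx by rewrite unitmxE det_ublock det1 mul1r.
exists (invmx Q *m B *m P).
  by rewrite !unitmx_mul unitmx_inv uQ uP uB.
have BE : B *m (P *m M *m P^T) *m B^T = Q *m N *m Q^T.
  rewrite PE QE /B tr_block_mx !mulmx_block.
  by rewrite !(mul1mx, mul0mx, addr0, add0r, trmx1, trmx0, mulmx1, mulmx0) TE.
transitivity (invmx Q *m (Q *m N *m Q^T) *m (invmx Q)^T).
  by rewrite -BE !trmx_mul !mulmxA.
by rewrite !mulmxA mulVmx // mul1mx -mulmxA -trmx_mul mulVmx // trmx1 mulmx1.
Qed.

(** * The sum-zero space over F_2 and its permutation representation *)

Lemma mulmx_const1 (R : nzRingType) m n p :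
  (const_mx 1 : 'M[R]_(m, n)) *m (const_mx 1 : 'M_(n, p)) = const_mx n%:R.
Proof.
apply/matrixP=> i j; rewrite !mxE (eq_bigr (fun=> 1)) => [|k _].
  by rewrite sumr_const card_ord.
by rewrite !mxE mulr1.
Qed.

Lemma F2_nat n : n%:R = (odd n)%:R :> 'F_2.
Proof.
by rewrite -[n in LHS]odd_double_half natrD -mul2n natrM pchar_Zp // mul0r
  addr0.
Qed.

Lemma F2_addmm m n (M : 'M['F_2]_(m, n)) : M + M = 0.
Proof. by apply/matrixP=> i j; rewrite !mxE addrr_pchar2 // pchar_Fp. Qed.

(** The vectors e_0 + e_i form a basis of the sum-zero space with Gram matrix J + I, J being
    all-ones. It is alternating because squaring is the identity on F_2, and it is its own inverse
    because J^2 = dJ = 0 for even d. A congruence carries it to [M]. *)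
Lemma sum_zero_gram d (M : 'M['F_2]_d) :
    ~~ odd d -> alternating_mx M -> M \in unitmx ->
  exists2 B : 'M['F_2]_(d, d.+1),
    B *m (const_mx 1 : 'cV_d.+1) = 0 & B *m B^T = M.
Proof.
move=> evd altM uM.
pose B : 'M['F_2]_(d, 1 + d) := row_mx (const_mx 1) 1%:M.
have B1 : B *m (const_mx 1 : 'cV_(1 + d)) = 0.
  rewrite -col_mx_const mul_row_col mul1mx mulmx_const1.
  by rewrite F2_addmm.
have BB : B *m B^T = const_mx 1 + 1%:M.
  by rewrite tr_row_mx mul_row_col trmx1 mulmx1 trmx_const mulmx_const1.
have uBB : B *m B^T \in unitmx.
  suff : (B *m B^T) *m (B *m B^T) = 1%:M by case/mulmx1_unit.
  rewrite BB mulmxDl !mulmxDr mulmx1 mul1mx mulmx1 mulmx_const1 F2_nat.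
  by rewrite (negPf evd) raddf0 add0r addrA F2_addmm add0r.
have altBB : alternating_mx (B *m B^T).
  move=> x; rewrite BB mulmxDr mulmx1 mulmxDl.
  apply/matrixP=> i j; rewrite !ord1 !mxE.
  have -> : \sum_k (x *m const_mx 1) 0 k * x^T k 0 = (\sum_k x 0 k) ^+ 2.
    rewrite expr2 mulr_sumr; apply: eq_bigr => k _; rewrite !mxE; congr (_ * _).
    by apply: eq_bigr => l _; rewrite mxE mulr1.
  have -> : \sum_k x 0 k * x^T k 0 = (\sum_k x 0 k) ^+ 2.
    have Fr (y : 'F_2) : y ^+ 2 = y.
      by have := expf_card y; rewrite card_Fp.
    by rewrite Fr; apply: eq_bigr => k _; rewrite mxE -expr2 Fr.
  by rewrite addrr_pchar2 // pchar_Fp.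
have [P uP PE] := alternating_unit_congr altBB uBB altM uM.
exists (P *m B); first by rewrite -mulmxA B1 mulmx0.
by rewrite trmx_mul -PE !mulmxA.
Qed.

(** The rows of [B] together with the all-ones row span the whole space: their Gram matrix is block
    diagonal with blocks [M] and d + 1 = 1, hence invertible. *)
Lemma sum_zero_mx_inj d (M : 'M['F_2]_d) (B : 'M['F_2]_(d, d.+1)) k
    (X Y : 'M['F_2]_(d.+1, k)) :
    ~~ odd d -> M \in unitmx ->
    B *m (const_mx 1 : 'cV_d.+1) = 0 -> B *m B^T = M ->
  B *m X = B *m Y -> (const_mx 1 : 'rV_d.+1) *m X = const_mx 1 *m Y -> X = Y.
Proof.
move=> evd uM B1 BB eqB eq1.
pose S : 'M['F_2]_(d + 1, d.+1) := col_mx B (const_mx 1).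
have SS : S *m S^T = block_mx M 0 0 1%:M.
  rewrite tr_col_mx mul_col_row BB trmx_const B1 mulmx_const1 F2_nat /= evd.
  congr block_mx; last by apply/matrixP=> i j; rewrite !ord1 !mxE.
  by rewrite -[LHS]trmxK trmx_mul trmx_const trmxK B1 trmx0.
have uSS : S *m S^T \in unitmx by rewrite SS unitmxE det_ublock det1 mulr1.
have rfS : row_full S.
  rewrite /row_full eqn_leq rank_leq_col /=.
  by apply: leq_trans (mxrankM_maxl S S^T); rewrite mxrank_unit // addn1.
have [R RS] := row_fullP rfS.
rewrite -[X]mul1mx -[Y]mul1mx -RS -!mulmxA; congr (_ *m _).
by rewrite !mul_col_mx eqB eq1.
Qed.

(** The witness [B^T *m invmx M] makes [C *m B] the orthogonal projection onto the sum-zero space,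
    which is checked on the rows of [B] and on the all-ones row. *)
Lemma sum_zero_section d (M : 'M['F_2]_d) (B : 'M['F_2]_(d, d.+1)) :
    ~~ odd d -> M \in unitmx ->
    B *m (const_mx 1 : 'cV_d.+1) = 0 -> B *m B^T = M ->
  exists2 C, B *m C = 1%:M & C *m B = 1%:M - const_mx 1.
Proof.
move=> evd uM B1 BB; exists (B^T *m invmx M); first by rewrite mulmxA BB mulmxV.
apply: (sum_zero_mx_inj evd uM B1 BB).
  rewrite !mulmxA BB mulmxV // mul1mx mulmxBr mulmx1 -[X in _ = B - _ *m
    X](@mulmx_const1 _ _ 1).
  by rewrite mulmxA B1 mul0mx subr0.
have -> : (const_mx 1 : 'rV['F_2]_d.+1) *m (B^T *m invmx M *m B) = 0.
  rewrite (_ : (const_mx 1 : 'rV_d.+1) = (const_mx 1 : 'cV_d.+1)^T).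
    by rewrite !mulmxA -trmx_mul B1 trmx0 !mul0mx.
  by rewrite trmx_const.
by rewrite mulmxBr mulmx1 mulmx_const1 F2_nat /= evd subrr.
Qed.

Lemma perm_const_mx m d (s : 'S_d.+1) :
  perm_mx s *m const_mx 1 = const_mx 1 :> 'M['F_2]_(d.+1, m).
Proof. by rewrite -row_permE; apply/matrixP=> i j; rewrite !mxE. Qed.

Lemma const_perm_mx m d (s : 'S_d.+1) :
  const_mx 1 *m perm_mx s = const_mx 1 :> 'M['F_2]_(m, d.+1).
Proof. by rewrite -[s]invgK -col_permE; apply/matrixP=> i j; rewrite !mxE. Qed.

(* The rows of B form a basis of the sum-zero vectors, and C reads off the    *)
(* coordinates in that basis of the projection along the all-ones vector.     *)
Section SumZeroRepresentation.

Variables (d : nat) (B : 'M['F_2]_(d, d.+1)) (C : 'M['F_2]_(d.+1, d)).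
Hypotheses (BC : B *m C = 1%:M) (CB : C *m B = 1%:M - const_mx 1).

Lemma mulB_const1 : B *m (const_mx 1 : 'M_d.+1) = 0.
Proof.
rewrite (_ : const_mx 1 = 1%:M - C *m B); last by rewrite CB subKr.
by rewrite mulmxBr mulmx1 mulmxA BC mul1mx subrr.
Qed.

Lemma mul_const1C : (const_mx 1 : 'M_d.+1) *m C = 0.
Proof.
rewrite (_ : const_mx 1 = 1%:M - C *m B); last by rewrite CB subKr.
by rewrite mulmxBl mul1mx -mulmxA BC mulmx1 subrr.
Qed.

Definition sum_zero_mx (s : 'S_d.+1) := B *m perm_mx s *m C.

Local Notation rho := sum_zero_mx.

Lemma sum_zero_mxB s : rho s *m B = B *m perm_mx s.
Proof.
by rewrite -mulmxA CB mulmxBr mulmx1 -(mulmxA B) perm_const_mx mulB_const1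
  subr0.
Qed.

Lemma mulC_sum_zero_mx s : C *m rho s = perm_mx s *m C.
Proof.
by rewrite !mulmxA CB !mulmxBl !mul1mx const_perm_mx mul_const1C subr0.
Qed.

Lemma sum_zero_mx1 : rho 1%g = 1%:M.
Proof. by rewrite /rho perm_mx1 mulmx1 BC. Qed.

Lemma sum_zero_mxM s t : rho (s * t)%g = rho s *m rho t.
Proof. by rewrite {2}/rho !mulmxA sum_zero_mxB /rho perm_mxM !mulmxA. Qed.

Lemma sum_zero_mx_unit s : rho s \in unitmx.
Proof.
have : rho s *m rho s^-1%g = 1%:M by rewrite -sum_zero_mxM mulgV sum_zero_mx1.
by move=> rsV; exact: (proj1 (mulmx1_unit rsV)).
Qed.

(** A permutation fixes the all-ones vector, so if it is trivial on the complementary sum-zero space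
    it is trivial everywhere. *)
Lemma sum_zero_mx_eq1 s : rho s = 1%:M -> s = 1%g.
Proof.
move=> rs1; have Ps1 : perm_mx s = 1%:M :> 'M['F_2]_d.+1.
  rewrite -[LHS]mul1mx -(subrK (const_mx 1) 1%:M) -CB mulmxDl const_perm_mx.
  by rewrite -mulmxA -sum_zero_mxB rs1 mul1mx CB subrK.
apply/permP=> i; rewrite perm1; have [// | nsi] := eqVneq (s i) i.
by move/matrixP/(_ i i): Ps1; rewrite !mxE eqxx (negPf nsi) => /eqP.
Qed.

Lemma sum_zero_mx_isometry M s : B *m B^T = M -> rho s *m M *m (rho s)^T = M.
Proof.
move=> <-; rewrite !mulmxA sum_zero_mxB -mulmxA -trmx_mul sum_zero_mxB trmx_mul.
by rewrite -mulmxA (mulmxA (perm_mx s)) tr_perm_mx -perm_mxM mulgV perm_mx1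
  mul1mx.
Qed.

(** The coordinates [w *m C] of a fixed sum-zero vector give an eigenvector for 1; they are non-zero
    because [B] recovers [w] from them. *)
Lemma det_sum_zero_mx_sub1 s (w : 'rV['F_2]_d.+1) :
    w != 0 -> w *m (const_mx 1 : 'cV_d.+1) = 0 -> w *m perm_mx s = w ->
  \det (rho s - 1%:M) = 0.
Proof.
move=> nzw w1 ws; apply/eqP/det0P; exists (w *m C).
  apply: contra_neq nzw => wC.
  have: w *m C *m B = 0 by rewrite wC mul0mx.
  rewrite -mulmxA CB mulmxBr mulmx1.
  by rewrite -(@mulmx_const1 _ _ 1) mulmxA w1 mul0mx subr0.
by rewrite mulmxBr mulmx1 -mulmxA mulC_sum_zero_mx mulmxA ws subrr.
Qed.

End SumZeroRepresentation.

(** * Cycles of affine maps over a finite field *)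

Lemma finField_card_pchar (F : finFieldType) :
  exists p k, [/\ prime p, p \in [pchar F] & #|F| = (p ^ k.+1)%N].
Proof.
pose p := pdiv #|F|.
have F_gt1 : (1 < #|F|)%N := finNzRing_gt1 F.
have p_pr : prime p by rewrite pdiv_prime.
have pF : #|F| = (p ^ logn p #|F|)%N.
  have := abelem_pgroup (finField_is_abelem F); rewrite cardsT => /card_pgroup.
  by rewrite cardsT.
exists p; case: (logn p _) pF => [| k] pF; first by rewrite pF in F_gt1.
by exists k; split=> //; apply: (card_finPcharP pF).
Qed.

(* In characteristic p the sum is (h - 1)^(p^e - 1), while h is unipotent.    *)
Lemma unipotent_geometric_sum (F : finFieldType) n (h : 'M[F]_n.+1) p s e :
    p \in [pchar F] -> h ^+ (p ^ s) = 1 -> (n.+1 < p ^ e)%N ->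
  \sum_(i < p ^ e) h ^+ i = 0.
Proof.
move=> pF hs ltn.
have Frob k : ('X - 1%:P) ^+ (p ^ k) = 'X^(p ^ k) - 1 :> {poly F}.
  have pk : [pchar {poly F}].-nat (p ^ k)%N.
    by rewrite pnatX pnatE ?pchar_poly ?pF //; apply: (pcharf_prime pF).
  by rewrite exprDn_pchar // exprNn_pchar // expr1n.
(* The minimal polynomial divides a power of X - 1, hence is one up to a scalar, and its degree is
   at most that of the characteristic polynomial. *)
have uni : horner_mx h (('X - 1%:P) ^+ n.+1) = 0.
  have dvd : mxminpoly h %| ('X - 1%:P) ^+ (p ^ s).
    apply: mxminpoly_min; rewrite Frob rmorphB rmorphXn /= horner_mx_X hs.
    by rewrite rmorph1 subrr.
  have [k _ eqk] := dvdp_exp_XsubCP dvd.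
  have lek : (k <= n.+1)%N.
    have := dvdp_leq _ (mxminpoly_dvd_char h).
    rewrite (eqp_size eqk) size_exp_XsubC size_char_poly ltnS => -> //.
    by rewrite -size_poly_gt0 size_char_poly.
  have /dvdpP[q qE] : mxminpoly h %| ('X - 1%:P) ^+ n.+1.
    by rewrite (eqp_dvdl _ eqk) dvdp_exp2l.
  by rewrite qE rmorphM /= mx_root_minpoly mulr0.
have sumE : \sum_(i < p ^ e) 'X^i = ('X - 1%:P) ^+ (p ^ e).-1 :> {poly F}.
  apply: (mulfI (negbT (polyXsubC_eq0 1))).
  by rewrite -subrX1 -Frob -exprS prednK // (leq_ltn_trans _ ltn).
have /(congr1 (horner_mx h)) := sumE.
rewrite rmorph_sum /= => sumhE.
transitivity (\sum_(i < p ^ e) horner_mx h 'X^i).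
  by apply: eq_bigr => i _; rewrite rmorphXn /= horner_mx_X.
rewrite sumhE -(subnK (_ : n.+1 <= (p ^ e).-1)%N); last first.
  by rewrite -ltnS prednK // (leq_ltn_trans _ ltn).
by rewrite exprD rmorphM /= uni mulr0.
Qed.

Lemma iter_affine (R : nzRingType) n (h : 'M[R]_n.+1) (a x : 'rV_n.+1) k :
  iter k (fun y => y *m h + a) x = x *m h ^+ k + a *m \sum_(i < k) h ^+ i.
Proof.
elim: k => [|k IHk] /=; first by rewrite big_ord0 mulmx0 addr0 mulmx1.
rewrite IHk mulmxDl -!mulmxA -addrA; congr (_ *m _ + _);
  first by rewrite exprSr.
rewrite big_ord_recl mulmxDr expr0 mulmx1 addrC; congr (_ + _ *m _).
by rewrite mulmx_suml; apply: eq_bigr => i _; rewrite exprSr.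
Qed.

(* If the orbit of 0 were everything, the linear part would be unipotent and  *)
(* 0 would return after |A| / p steps.                                        *)
Lemma affine_orbit_proper (F : finFieldType) n (h : 'M[F]_n.+1)
    (a : 'rV_n.+1) :
    odd #|F| -> ~~ prime #|'rV[F]_n.+1| -> h \in unitmx ->
  exists x, ~~ fconnect (fun y => y *m h + a) 0 x.
Proof.
move=> oddF nprA uh; set T := (fun y => y *m h + a).
have injT : injective T.
  by move=> x y eqT; apply: (can_inj (mulmxK uh)); apply: (addIr a); exact: eqT.
apply/existsP; apply: contraT; rewrite negb_exists => /forallP-allc.
have {}allc x : fconnect T 0 x by apply/negPn.
have [p [k [p_pr pF cardF]]] := finField_card_pchar F.
have p_gt2 : (2 < p)%N.
  rewrite ltn_neqAle prime_gt1 // andbT; apply: contraL oddF => /eqP p2.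
  by rewrite cardF -p2 oddX.
have cardA : #|'rV[F]_n.+1| = (p ^ (k.+1 * n.+1))%N.
  by rewrite card_mx cardF mul1n expnM.
(* The exponent of p in |A| is at least 2, because |A| is not prime. *)
have [s sE] : exists s, (k.+1 * n.+1)%N = s.+2.
  case: (k.+1 * n.+1)%N cardA (muln_gt0 k.+1 n.+1) => [|[|s]] // cA _;
    last by exists s.
  by rewrite cA expn1 p_pr in nprA.
rewrite sE in cardA.
have ord0 : fingraph.order T 0 = (p ^ s.+2)%N.
  by rewrite /fingraph.order -cardA; apply: eq_card => x; rewrite !inE allc.
(* The map [T] iterated |A| times fixes 0 and every point of its cycle, hence every [x]; its
   translation part is therefore 0 and its linear part [h ^+ (p ^ s.+2)] is the identity. *)
have hN : h ^+ (p ^ s.+2) = 1.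
  apply/row_matrixP=> i; rewrite !rowE -[RHS]/(_ *m 1%:M) mulmx1.
  have := iter_affine h a 0 (p ^ s.+2);
    rewrite -/T -ord0 iter_order // mul0mx add0r => S0.
  set x : 'rV_n.+1 := delta_mx 0 i.
  have := iter_affine h a x (fingraph.order T 0); rewrite -/T -S0 addr0 => <-.
  by rewrite -(iter_findex (allc x)) -iterD addnC iterD iter_order.
(* Oddness of p matters here: for s = 0 the bound reads 2 < p. *)
have ltn : (n.+1 < p ^ s.+1)%N.
  have le_ns : (n.+1 <= s.+2)%N by rewrite -sE leq_pmull.
  apply: leq_ltn_trans le_ns _.
  elim: s {sE cardA ord0 hN} => [|s IHs]; first by rewrite expn1.
  rewrite expnS; apply: leq_ltn_trans IHs _.
  by rewrite ltn_Pmull ?expn_gt0 ?prime_gt0 // prime_gt1.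
have := iter_affine h a 0 (p ^ s.+1).
rewrite (unipotent_geometric_sum pF hN ltn) mulmx0 mul0mx addr0 -/T => iter0.
(* The point 0 recurs at time [p ^ s.+1], before its cycle of length [p ^ s.+2] closes: a
   contradiction. *)
have := @findex_iter _ T 0 (p ^ s.+1);
  rewrite iter0 ord0 ltn_exp2l ?prime_gt1 //.
have := @findex_iter _ T 0 0;
  rewrite fingraph.order_gt0 /= => -> // /(_ (ltnSn _)) pe0.
have : (0 < p ^ s.+1)%N by rewrite expn_gt0 prime_gt0.
by rewrite -pe0.
Qed.

(** * The affine group as permutations of A, its invariant matrices and its submodules *)

Section AffineAction.

Variables (F : finFieldType) (n : nat) (H : {group {'GL_n[F]}}).

Local Notation A := 'rV[F]_n.-1.+1.
Local Notation G := (affine_group H).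

Definition linear_part (g : G) : {'GL_n[F]} :=
  (val (g : sdprod_by ('MR (natural_repr H))%gact)).1.
Definition translation_part (g : G) : A :=
  (val (g : sdprod_by ('MR (natural_repr H))%gact)).2.

Definition affine_act (g : G) (x : A) : A :=
  x *m GLval (linear_part g) + translation_part g.

Lemma linear_partP g : linear_part g \in H.
Proof. have := valP (g : sdprod_by ('MR (natural_repr H))%gact).
by rewrite inE => /andP[]. Qed.

Lemma affine_act1 x : affine_act 1%g x = x.
Proof. by rewrite /affine_act /= mulmx1 addr0. Qed.

Lemma affine_actM g k x : affine_act (g * k)%g x = affine_act k (affine_act g
  x).
Proof.
rewrite /affine_act mulmxDl -mulmxA -addrA; congr (_ + _).
have -> : translation_part (g * k)%g
        = mx_repr_act (natural_repr H) (translation_part g) (linear_part k)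
          + translation_part k by [].
by rewrite mx_repr_actE ?linear_partP.
Qed.

Lemma affine_act_inj g : injective (affine_act g).
Proof.
by apply: (can_inj (g := affine_act g^-1%g)) => x;
  rewrite -affine_actM mulgV affine_act1.
Qed.

Lemma affine_act_faithful g : affine_act g =1 id -> g = 1%g.
Proof.
move=> g1; have a0 : translation_part g = 0.
  by have := g1 0; rewrite /affine_act mul0mx add0r.
have h1 : linear_part g = 1%g.
  apply: val_inj; apply/row_matrixP=> i; rewrite !rowE.
  by have := g1 (delta_mx 0 i); rewrite /affine_act a0 addr0 /= mulmx1.
by apply: val_inj; move: h1 a0; rewrite /linear_part /translation_part /=;
  case: (val _) => h a /= -> ->.
Qed.

Lemma affine_act_ext g k : affine_act g =1 affine_act k -> g = k.
Proof.
move=> gk; apply: (mulIg k^-1%g); rewrite mulgV.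
by apply: affine_act_faithful => x;
  rewrite affine_actM gk -affine_actM mulgV affine_act1.
Qed.

Lemma translation_proof (a : A) : (1%g, a) \in setX H [set: A].
Proof. by rewrite !inE group1. Qed.

Definition translation (a : A) : G :=
  SdPair ('MR (natural_repr H))%gact (translation_proof a).

Lemma translationE a x : affine_act (translation a) x = x + a.
Proof. by rewrite /affine_act /= mulmx1. Qed.

Lemma linear_elt (h : {'GL_n[F]}) :
  h \in H -> exists g : G, forall x, affine_act g x = x *m GLval h.
Proof.
move=> Hh; have hP : (h, 0 : A) \in setX H [set: A] by rewrite !inE Hh.
exists (SdPair ('MR (natural_repr H))%gact hP : G) => x.
by rewrite /affine_act /= addr0.
Qed.

Variables (d : nat) (eta : A -> 'I_d.+1) (theta : 'I_d.+1 -> A).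
Hypotheses (etaK : cancel eta theta) (thetaK : cancel theta eta).

Fact affine_perm_inj g : injective (fun i => eta (affine_act g (theta i))).
Proof.
by move=> i j /(can_inj etaK)/affine_act_inj/(can_inj thetaK).
Qed.

Definition affine_perm g : 'S_d.+1 := perm (affine_perm_inj (g := g)).

Lemma affine_permE g x : affine_perm g (eta x) = eta (affine_act g x).
Proof. by rewrite permE etaK. Qed.

Lemma affine_permM g k : affine_perm (g * k)%g = (affine_perm g * affine_perm
  k)%g.
Proof.
by apply/permP=> i; rewrite permM -(thetaK i) !affine_permE affine_actM.
Qed.

Lemma affine_perm_eq1 g : affine_perm g = 1%g -> g = 1%g.
Proof.
move=> pg1; apply: affine_act_faithful => x; apply: (can_inj etaK).
by rewrite -affine_permE pg1 perm1.
Qed.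

(** These are the convolution operators, that is, the group algebra of A over F_2. *)
Definition translation_invariant (E : 'M['F_2]_d.+1) :=
  forall a x y, E (eta (x + a)) (eta (y + a)) = E (eta x) (eta y).

(** Convolution on an abelian group is commutative: substituting x + y - z for the summation
    variable z exchanges the two factors. *)
Lemma translation_invariant_comm E E' :
  translation_invariant E -> translation_invariant E' -> E *m E' = E' *m E.
Proof.
move=> tE tE'; apply/matrixP=> i j; rewrite -(thetaK i) -(thetaK j) !mxE.
move: (theta i) (theta j) => x y.
pose r k := eta (x + y - theta k).
have rK : involutive r by move=> k; rewrite /r etaK subKr thetaK.
rewrite (reindex_inj (inv_inj rK)); apply: eq_bigr => k _.
rewrite mulrC -(thetaK k) /r etaK; move: (theta k) => z; congr (_ * _).
  rewrite -[RHS](tE' (y - z)); congr (E' (eta _) (eta _));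
    first by rewrite addrA.
  by rewrite addrC subrK.
rewrite -[LHS](tE (z - x)); congr (E (eta _) (eta _));
  first by rewrite addrC subrK.
by rewrite addrA subrK addrAC subrr add0r.
Qed.

Hypothesis H_trans :
  [transitive H, on [set v : A | v != 0] | 'MR (natural_repr H)].

(** A translation moves one index to 0 and [H] moves the other to [v0], so only the diagonal value
    and one off-diagonal value remain. *)
Lemma two_transitive_mx (E : 'M['F_2]_d.+1) :
    (forall g i j, E (affine_perm g i) (affine_perm g j) = E i j) ->
  exists al be, E = al%:M + const_mx be.
Proof.
move=> invE; have invEA g x y : E (eta (affine_act g x)) (eta (affine_act g y))
    = E (eta x) (eta y) by rewrite -!affine_permE invE.
have tE : translation_invariant E.
  by move=> a x y; rewrite -!(translationE a) invEA.
have /imsetP[v0 _ defS] := H_trans.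
exists (E (eta 0) (eta 0) - E (eta 0) (eta v0)); exists (E (eta 0) (eta v0)).
apply/matrixP=> i j; rewrite -(thetaK i) -(thetaK j) !mxE (inj_eq (can_inj
  etaK)).
move: (theta i) (theta j) => x y; rewrite -(tE (- x)) subrr.
have [-> | nxy] := eqVneq x y; first by rewrite subrr mulr1n subrK.
rewrite mulr0n add0r.
have yxn0 : y - x != 0 by rewrite subr_eq0 eq_sym.
have [h Hh ->] : exists2 h, h \in H & y - x = v0 *m GLval h.
  have : y - x \in [set v : A | v != 0] by rewrite inE.
  by rewrite defS => /orbitP[h Hh <-]; exists h; rewrite //= mx_repr_actE.
have [g gE] := linear_elt Hh.
by have := invEA g 0 v0; rewrite !gE mul0mx.
Qed.

Variables (B : 'M['F_2]_(d, d.+1)) (C : 'M['F_2]_(d.+1, d)).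
Hypotheses (BC : B *m C = 1%:M) (CB : C *m B = 1%:M - const_mx 1).

Local Notation rho g := (sum_zero_mx B C (affine_perm g)).

(** Extending [f] by zero on the all-ones line gives a matrix invariant under the affine group; in
    its form aI + bJ the J term vanishes on sum-zero vectors. *)
Lemma affine_centralizer_scalar (f : 'M['F_2]_d) :
  (forall g, f *m rho g = rho g *m f) -> is_scalar_mx f.
Proof.
move=> cf; have [g i j|al [be fE]] := @two_transitive_mx (C *m f *m B).
  set s := affine_perm g; rewrite -(perm_mx_conjE s);
    congr (fun_of_matrix _ _ _).
  have -> : perm_mx s *m (C *m f *m B) = C *m f *m B *m perm_mx s.
    move: (cf g) (mulC_sum_zero_mx BC CB s) (sum_zero_mxB BC CB s).
    rewrite -/s; move: (sum_zero_mx B C s) => r fr Cr rB.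
    by rewrite !mulmxA -Cr -(mulmxA C) -fr mulmxA -mulmxA rB mulmxA.
  by rewrite -(mulmxA _ (perm_mx s)) -perm_mxM mulgV perm_mx1 mulmx1.
apply/is_scalar_mxP; exists al.
have : B *m (C *m f *m B) *m C = f.
  by rewrite !mulmxA BC mul1mx -mulmxA BC mulmx1.
move=> <-; rewrite fE mulmxDr mulmxDl mul_mx_scalar -scalemxAl BC scalemx1.
have -> : const_mx be = be *: (const_mx 1 : 'M_d.+1).
  by apply/matrixP=> i j; rewrite !mxE mulr1.
by rewrite -scalemxAr (mulB_const1 BC CB) scaler0 mul0mx addr0.
Qed.

Lemma affine_submodule_full (U : 'M['F_2]_d) :
    odd #|A| -> U != 0 -> (forall g, (U *m rho g <= U)%MS) -> row_full U.
Proof.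
move=> oddA nzU modU; have [W WUB] : exists W, W = U *m B by eexists.
pose P g : 'M['F_2]_d.+1 := perm_mx (affine_perm g).
have PM g k : P (g * k)%g = P g *m P k by rewrite /P affine_permM perm_mxM.
have P1 : P 1%g = 1%:M.
  rewrite /P (_ : affine_perm 1%g = 1%g) ?perm_mx1 //.
  by apply/permP=> i; rewrite -(thetaK i) affine_permE affine_act1 perm1.
have PV g : P g^-1%g = perm_mx (affine_perm g)^-1%g.
  by rewrite -[LHS]mul1mx -[1%:M]perm_mx1 -(mulVg (affine_perm g)) perm_mxM
    -mulmxA -PM mulgV P1 mulmx1.
have modW g k (w : 'M_(k, _)) : (w <= W)%MS -> (w *m P g <= W)%MS.
  move/(submxMr (P g))/submx_trans; apply.
  by rewrite WUB -mulmxA -(sum_zero_mxB BC CB) mulmxA submxMr.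
have [E0 [WE0 E0W]] : exists E0, (forall k (w : 'M_(k, d.+1)), (w <= W)%MS ->
    w *m E0 = w) /\ (E0 <= W)%MS.
  exists (pinvmx W *m W); split=> [k w wW|]; last exact: submxMl.
  by rewrite mulmxA mulmxKpV.
(* Maschke averaging without division: the number |A| of summands is odd, so it equals 1 in F_2. *)
pose E := \sum_(a : A) P (translation a)^-1%g *m E0 *m P (translation a).
have WE k (w : 'M_(k, _)) : (w <= W)%MS -> w *m E = w.
  move=> wW; rewrite mulmx_sumr (eq_bigr (fun=> w)) => [|a _].
    rewrite sumr_const; apply/matrixP=> i j.
    by rewrite mulmxnE -mulr_natr F2_nat oddA mulr1.
  rewrite !mulmxA WE0 ?modW //.
  by rewrite -mulmxA -PM mulVg P1 mulmx1.
have EW : (E <= W)%MS.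
  by apply: summx_sub => a _; apply: modW; apply: submx_trans E0W;
    apply: submxMl.
have tE : translation_invariant E.
  move=> b x y; rewrite -!(translationE b) -!affine_permE -perm_mx_conjE.
  congr (fun_of_matrix _ _ _).
  rewrite mulmx_sumr mulmx_suml [RHS](reindex_inj (addIr (- b))).
  apply: eq_bigr => a _ /=; rewrite -PV -/(P _) !mulmxA -PM -!mulmxA -PM.
  have -> : translation (a - b) = (translation a * (translation b)^-1)%g.
    apply: (canRL (mulgK _)); apply: affine_act_ext => z.
    by rewrite affine_actM !translationE -addrA subrK.
  by rewrite invMg invgK.
have invE g i j : E (affine_perm g i) (affine_perm g j) = E i j.
  (* [E'] is again a translation-invariant projection onto [W], as translations form a normal
     subgroup. Two commuting projections onto the same space agree: E' = E'E = EE' = E. *)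
  pose E' := P g *m E *m P g^-1%g.
  suff eqE : E' = E by rewrite -[in RHS]eqE /E' PV perm_mx_conjE.
  have WE' k (w : 'M_(k, _)) : (w <= W)%MS -> w *m E' = w.
    by move=> wW; rewrite !mulmxA WE ?modW // -mulmxA -PM mulgV P1 mulmx1.
  have EW' : (E' <= W)%MS by apply: modW; apply: submx_trans EW; apply: submxMl.
  have tE' : translation_invariant E'.
    move=> a x y; rewrite /E' PV !perm_mx_conjE !affine_permE.
    by rewrite /affine_act !mulmxDl !(addrAC _ (a *m _)) tE.
  by rewrite -(WE _ _ EW') -translation_invariant_comm // WE'.
have [al [be Eab]] := two_transitive_mx invE.
have nzW : W != 0.
  apply: contra_neq nzU => W0.
  by rewrite -[U]mulmx1 -BC mulmxA -WUB W0 mul0mx.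
(* Thus [E] acts on V as the scalar [al], which is non-zero because [E] fixes the non-zero [W];
   hence V lies in [W]. *)
have BE : B *m E = al *: B.
  rewrite Eab mulmxDr mul_mx_scalar.
  have -> : const_mx be = be *: (const_mx 1 : 'M_d.+1).
    by apply/matrixP=> i j; rewrite !mxE mulr1.
  by rewrite -scalemxAr (mulB_const1 BC CB) scaler0 addr0.
have al1 : al != 0.
  apply: contra_neq nzW => al0.
  by rewrite -(WE _ W (submx_refl W)) WUB -mulmxA BE al0 scale0r mulmx0.
have BW : (B <= W)%MS.
  by rewrite -(eqmx_scale _ al1) -BE (submx_trans (submxMl _ _)).
rewrite -sub1mx -BC; apply: submx_trans (submxMr C BW) _.
by rewrite WUB -mulmxA BC mulmx1.
Qed.

End AffineAction.

(* The orbit of 0 or its complement has even size. *)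
Lemma affine_invariant_even_set (F : finFieldType) n (H : {group {'GL_n[F]}})
    (g : affine_group H) :
    odd #|F| -> ~~ prime #|'rV[F]_n.-1.+1| ->
  exists S : {set 'rV[F]_n.-1.+1},
    [/\ S != set0, ~~ odd #|S| & forall x, (affine_act g x \in S) = (x \in S)].
Proof.
move=> oddF nprA.
have uh : GLval (linear_part g) \in unitmx by exact: GL_unitmx.
have [x0 nx0] := affine_orbit_proper (translation_part g) oddF nprA uh.
pose O := [set x | fconnect (affine_act g) 0 x].
have OT x : (affine_act g x \in O) = (x \in O).
  by rewrite !inE -same_fconnect1_r //; apply: affine_act_inj.
have [oddO | evO] := boolP (odd #|O|); last first.
  by exists O; split=> //; apply/set0Pn; exists 0; rewrite inE connect0.
exists (~: O); split=> [||x]; last by rewrite !in_setC OT.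
  by apply/set0Pn; exists x0; rewrite !inE.
by have := cardsC O; move/(congr1 odd);
  rewrite oddD oddO card_mx oddX oddF orbT; case: (odd _).
Qed.

(** The indicator of an invariant non-empty set of even size is a non-zero fixed vector with
    coordinate sum 0. *)
Lemma det_affine_sub1 (F : finFieldType) n (H : {group {'GL_n[F]}})
    d (eta : 'rV[F]_n.-1.+1 -> 'I_d.+1) (theta : 'I_d.+1 -> 'rV_n.-1.+1)
    (etaK : cancel eta theta) (thetaK : cancel theta eta)
    (B : 'M['F_2]_(d, d.+1)) (C : 'M['F_2]_(d.+1, d)) (g : affine_group H) :
    B *m C = 1%:M -> C *m B = 1%:M - const_mx 1 ->
    odd #|F| -> ~~ prime #|'rV[F]_n.-1.+1| ->
  \det (sum_zero_mx B C (affine_perm etaK thetaK g) - 1%:M) = 0.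
Proof.
move=> BC CB oddF nprA.
have [S [nzS evS invS]] := affine_invariant_even_set g oddF nprA.
pose w : 'rV['F_2]_d.+1 := \row_i (theta i \in S)%:R.
apply: (det_sum_zero_mx_sub1 BC CB (w := w)).
- have /set0Pn[x Sx] := nzS; apply/eqP => /rowP/(_ (eta x))/eqP.
  by rewrite !mxE etaK Sx.
- apply/matrixP=> i j; rewrite !mxE.
  under eq_bigr => k _ do rewrite !mxE mulr1.
  rewrite -natr_sum (reindex eta) /=; last by exists theta => ? _.
  under eq_bigr => x _ do rewrite etaK.
  by rewrite -big_mkcond sum1_card F2_nat (negPf evS).
rewrite -[affine_perm _ _ g]invgK -col_permE; apply/rowP=> j; rewrite !mxE.
rewrite -[j in RHS](permKV (affine_perm etaK thetaK g)).
move: ((affine_perm etaK thetaK g)^-1%g j) => i.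
by rewrite -(thetaK i) affine_permE !etaK invS.
Qed.

(** * From symplectic forms to invertible alternating matrices *)

Section FormMatrix.

Variables (F : fieldType) (d : nat) (f : {skew_symmetric 'rV[F]_d}).

Lemma skew_form_mxE u v : f u v = (u *m matrix_of_form f *m v^T) 0 0.
Proof. by rewrite -matrix_of_formK /form_of_matrix trace_mx11 map_mx_id. Qed.

Lemma symplectic_mx_unit : is_psymplectic f -> matrix_of_form f \in unitmx.
Proof.
case=> /eqP ndf _ _; rewrite unitmxE unitfE; apply/negP => /det0P[u nzu uM].
case/negP: nzu; rewrite -memv0 -ndf; apply/mem_orthovP => v _.
by rewrite skew_form_mxE uM mul0mx mxE.
Qed.

Lemma symplectic_mx_alternating :
  2 \in [pchar F] -> is_psymplectic f -> alternating_mx (matrix_of_form f).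
Proof.
move=> F2 [_ _ altf] x; apply/matrixP=> i j.
by rewrite !ord1 -skew_form_mxE altf // mxE.
Qed.

End FormMatrix.

Theorem theorem4p1 (q : nat) (F : finFieldType) (cardF : #|F| = q)
    (q_odd : odd q) (n : nat) (n_gt0 : (0 < n)%N)
    (H : {group {'GL_n[F]}})
    (H_trans : [transitive H, on [set v : 'rV[F]_n.-1.+1 | v != 0]
                 | 'MR (natural_repr H)])
    (m : nat) (m_def : m = ((#|'rV[F]_n.-1.+1| - 1) %/ 2)%N)
    (n_q : (1 < n)%N \/ n = 1%N /\ ~~ prime q)
    (f : {skew_symmetric 'rV['F_2]_(2 * m).-1.+1})
    (f_sympl : is_psymplectic f) :
  exists X : {group {'GL_(2 * m)['F_2]}},
    [/\ X \subset Sp f,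
        mx_absolutely_irreducible (natural_repr X),
        fixed_point_subgroup X &
        X \isog [set: affine_group H]].
Proof.
have oddF : odd #|F| by rewrite cardF.
have cardA : #|'rV[F]_n.-1.+1| = (q ^ n)%N by rewrite card_mx cardF mul1n
  prednK.
have oddA : odd #|'rV[F]_n.-1.+1| by rewrite cardA oddX q_odd orbT.
have nprA : ~~ prime #|'rV[F]_n.-1.+1|.
  rewrite cardA; case: n_q => [n_gt1 | [-> //]].
  apply/primePn; right; exists q; last by rewrite dvdn_exp.
  have q_gt1 : (1 < q)%N by rewrite -cardF finNzRing_gt1.
  by rewrite q_gt1 -{1}[q]expn1 ltn_exp2l.
have A_gt1 : (1 < #|'rV[F]_n.-1.+1|)%N.
  rewrite cardA; have q_gt1 : (1 < q)%N by rewrite -cardF finNzRing_gt1.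
  by rewrite -{1}(expn0 q) ltn_exp2l.
have m2 : (2 * m)%N = #|'rV[F]_n.-1.+1|.-1.
  rewrite m_def subn1 mulnC divnK // dvdn2.
  by have := oddA; rewrite -{1}(prednK (ltnW A_gt1)).
(* This is 2m itself, since |A| > 1 makes 2m positive; hence |A| = d + 1. *)
set d := (2 * m).-1.+1 in f f_sympl *.
have dE : d = #|'rV[F]_n.-1.+1|.-1.
  by rewrite /d m2 prednK // -ltnS (prednK (ltnW A_gt1)).
have cardd : #|'rV[F]_n.-1.+1| = d.+1 by rewrite dE (prednK (ltnW A_gt1)).
have evd : ~~ odd d by rewrite -oddS -cardd.
pose eta x : 'I_d.+1 := cast_ord cardd (enum_rank x).
pose theta (i : 'I_d.+1) : 'rV[F]_n.-1.+1 := enum_val (cast_ord (esym cardd) i).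
have etaK : cancel eta theta by move=> x; rewrite /theta cast_ordK enum_rankK.
have thetaK : cancel theta eta by move=> i; rewrite /eta enum_valK cast_ordKV.
pose M := matrix_of_form f.
have uM : M \in unitmx by exact: symplectic_mx_unit.
have altM : alternating_mx M.
  by apply: symplectic_mx_alternating => //; apply: pchar_Fp.
have [B B1 BB] := sum_zero_gram evd altM uM.
have [C BC CB] := sum_zero_section evd uM B1 BB.
pose rho (g : affine_group H) := sum_zero_mx B C (affine_perm etaK thetaK g).
have rho_unit g : rho g \is a GRing.unit by exact: sum_zero_mx_unit.
pose phi g : {'GL_(2 * m)['F_2]} := FinRing.unit _ (rho_unit g).
have phiM : {in [set: affine_group H] &, {morph phi : g k / (g * k)%g}}.
  move=> g k _ _; apply: val_inj; rewrite /= /rho affine_permM.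
  exact: sum_zero_mxM.
pose mor := Morphism phiM.
exists (mor @* [set: affine_group H])%G; split.
- apply/subsetP=> _ /morphimP[g _ _ ->]; apply/SpP=> u v.
  rewrite !skew_form_mxE trmx_mul /=.
  have := sum_zero_mx_isometry BC CB (affine_perm etaK thetaK g) BB.
  rewrite -/(rho g) -/M => {2}<-.
  by rewrite !mulmxA.
- set rG := natural_repr _.
  have rGE g : rG (mor g) = rho g by [].
  have morX g : mor g \in (mor @* [set: affine_group H])%g by apply:
    mem_morphim; rewrite inE.
  have irr : mx_irreducible rG.
    apply/mx_irrP; split=> // U /mxmoduleP modU nzU.
    apply: (affine_submodule_full (etaK := etaK) (thetaK := thetaK) H_trans BC
      CB oddA nzU) => g.
    by have := modU (mor g) (morX g); rewrite rGE.
  (* An irreducible representation whose commutant consists of scalars is absolutely irreducible. *)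
  apply: cent_mx_scalar_abs_irr => //; rewrite leqNgt.
  apply/(has_non_scalar_mxP (scalar_mx_cent _ _)) => [[c cGc]].
  case/negP; apply: (affine_centralizer_scalar (etaK := etaK) (thetaK := thetaK)
           H_trans BC CB) => g.
  move: cGc; rewrite memmx_cent_envelop => /centgmxP/(_ _ (morX g)).
  by rewrite rGE.
- move=> _ /morphimP[g _ _ ->].
  exact: (det_affine_sub1 etaK thetaK g BC CB oddF nprA).
rewrite isog_sym; apply: sub_isog => //; apply/injmP => g k _ _ eqgk.
apply: (mulIg k^-1%g); rewrite mulgV.
apply: (affine_perm_eq1 (etaK := etaK) (thetaK := thetaK)).
apply: (sum_zero_mx_eq1 BC CB).
have -> : sum_zero_mx B C (affine_perm etaK thetaK (g * k^-1)) = GLval (mor (g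
  * k^-1)%g) by [].
by rewrite morphM ?inE // morphV ?inE // eqgk mulgV.
Qed.
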